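(* Let $G$ be a graph of order $m\geq 2$ each of whose connected components is isomorphic to a path $P_i$ for some $1\leq i\leq m$. Let $t$ be the number of components of $G$ having an odd number of vertices. Then $$\alpha(F_2(G))=\frac{m^2+t^2-2t}{4}.$$
   Context: $P_i$ is the path graph on $i$ vertices. For a finite simple graph $G$, the $2$-token graph $F_2(G)$ is the graph whose vertices are the $2$-element subsets of $V(G)$, two such subsets being adjacent iff their symmetric difference is an edge of $G$. $\alpha$ denotes independence number. *)

(* Defs.v *)
From mathcomp Require Import all_boot.

Set Implicit Arguments.
Unset Strict Implicit.
Unset Printing Implicit Defensive.

Record sgraph := SGraph {
  vertex :> finType;
  adj : rel vertex;
  adj_sym : symmetric adj;
  adj_irr : irreflexive adj }.

Definition edges (G : sgraph) : {set {set G}} :=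
  [set [set p.1; p.2] | p in [set p : G * G | adj p.1 p.2]].

Definition isomorphic (G H : sgraph) : Prop :=
  exists2 f : G -> H, bijective f & forall x y, adj (f x) (f y) = adj x y.

Section Induced.
Variables (G : sgraph) (S : {set G}).

Definition induced_adj : rel {x : G | x \in S} :=
  fun x y => adj (val x) (val y).

Lemma induced_sym : symmetric induced_adj.
Proof. by move=> x y; apply: adj_sym. Qed.

Lemma induced_irr : irreflexive induced_adj.
Proof. by move=> x; apply: adj_irr. Qed.

Definition induced : sgraph := SGraph induced_sym induced_irr.
End Induced.

(* The vertex sets of the connected components; the components themselves are
   the corresponding induced subgraphs. *)
Definition components (G : sgraph) : {set {set G}} :=
  equivalence_partition (connect (@adj G)) [set: G].

Section PathGraph.
Variable n : nat.

Definition path_adj : rel 'I_n :=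
  fun i j => (i.+1 == j :> nat) || (j.+1 == i :> nat).

Lemma path_sym : symmetric path_adj.
Proof. by move=> i j; rewrite /path_adj orbC. Qed.

Lemma path_irr : irreflexive path_adj.
Proof. by move=> i; rewrite /path_adj orbb gtn_eqF. Qed.

Definition path_graph : sgraph := SGraph path_sym path_irr.
End PathGraph.

Definition symdiff (T : finType) (A B : {set T}) : {set T} :=
  (A :\: B) :|: (B :\: A).

Section TokenGraph.
Variables (k : nat) (G : sgraph).

Definition token_adj : rel {A : {set G} | #|A| == k} :=
  fun A B => symdiff (val A) (val B) \in edges G.

Lemma token_sym : symmetric token_adj.
Proof. by move=> A B; rewrite /token_adj /symdiff setUC. Qed.

Lemma token_irr : irreflexive token_adj.
Proof.
move=> A; rewrite /token_adj /symdiff setDv setU0.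
apply/imsetP => -[[x y] _ /setP /(_ x)].
by rewrite !inE eqxx.
Qed.

Definition token_graph : sgraph := SGraph token_sym token_irr.
End TokenGraph.

Definition independent (G : sgraph) (S : {set G}) : bool :=
  [forall x in S, forall y in S, ~~ adj x y].

Definition independence_number (G : sgraph) : nat :=
  \max_(S : {set G} | independent S) #|S|.

(* Main.v *)
Require Import Defs.
From mathcomp Require Import all_boot all_order all_algebra.
From mathcomp Require Import zify lra.
Import Order.TTheory GRing.Theory Num.Theory.

(** A path carries a matching involution [mu], each vertex being fixed or
    adjacent to its image, with one fixed vertex if the path is odd and none
    otherwise.  On ordered pairs let [tau (x, y)] be [(x, mu y)] if [mu]
    moves [y] and [(mu x, y)] if not; it fixes exactly the [t ^ 2] pairs of
    fixed vertices.  Let [P] be the set of ordered pairs representing an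
    independent set [S] of the token graph, so [#|P| = 2 #|S|].  Then [P] and
    [tau P] meet only in off-diagonal fixed pairs and miss the [t] diagonal
    ones, whence [4 #|S| <= (m ^ 2 - t) + (t ^ 2 - t)].  Equality holds for the
    pairs [{x, y}] that have distinct colours when [x], [y] lie in the same
    component and equal colours otherwise, for a proper 2-colouring giving all
    the fixed vertices the same colour. *)

(** * Matching involutions and 2-colourings of linear forests *)

Definition pairing (H : sgraph) (mu : H -> H) (c : H -> bool) : Prop :=
  [/\ involutive mu, (forall x, mu x != x -> adj x (mu x)),
      (forall x y : H, adj x y -> c x != c y) & (forall x, mu x = x -> c x)].

Arguments pairing {H} mu c.

(** The involution swaps [2k] with [2k+1], so only the last vertex of an odd path stays fixed. Its
    index is even, hence the parity colouring gives it [true]. *)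
Lemma path_pairing n : exists (mu : path_graph n -> path_graph n) c,
  [/\ pairing mu c, (forall x y, mu x = x -> mu y = y -> x = y)
    & [exists x, mu x == x] = odd n].
Proof.
pose s (j : nat) := if odd j then j.-1 else if j.+1 < n then j.+1 else j.
have sP (j : 'I_n) : s j < n by rewrite /s; have := ltn_ord j; do !case: ifP; lia.
exists (fun j : 'I_n => Ordinal (sP j)), (fun j : 'I_n => ~~ odd j).
split; first split.
- by move=> j; apply: val_inj; rewrite /= /s; have := ltn_ord j; do !case: ifP; lia.
- move=> j; rewrite -val_eqE /= /path_adj /= /s.
  by have := ltn_ord j; do !case: ifP; lia.
- by move=> x y; rewrite /= /path_adj; lia.
- by move=> j /(congr1 val) /=; rewrite /s; case: ifP; lia.
- move=> x y /(congr1 val) /= hx /(congr1 val) /= hy; apply: val_inj => /=.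
  move: hx hy; rewrite /s; have := ltn_ord x; have := ltn_ord y.
  by do !case: ifP; lia.
apply/existsP/idP => [[j /eqP /(congr1 val)] /= | on].
  by rewrite /s; have := ltn_ord j; do !case: ifP; lia.
have ltn : n.-1 < n by lia.
exists (Ordinal ltn); rewrite -val_eqE /= /s.
by do !case: ifP; lia.
Qed.

Lemma isomorphic_path_pairing (H : sgraph) n : isomorphic H (path_graph n) ->
  exists (mu : H -> H) c,
  [/\ pairing mu c, (forall x y, mu x = x -> mu y = y -> x = y)
    & [exists x, mu x == x] = odd #|H|].
Proof.
case=> f [g fK gK] f_adj; have [mu [c [[muK muA cA muc] mu1 mux]]] := path_pairing n.
have fixE x : g (mu (f x)) = x -> mu (f x) = f x by move=> {2}<-; rewrite gK.
exists (fun x => g (mu (f x))), (fun x => c (f x)).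
split; first split.
- by move=> x; rewrite gK muK fK.
- move=> x hx; rewrite -f_adj gK; apply: muA.
  by apply: contra hx => /eqP ->; rewrite fK.
- by move=> x y; rewrite -f_adj; apply: cA.
- by move=> x /fixE/muc.
- by move=> x y /fixE hx /fixE hy; apply: (can_inj fK); apply: mu1.
have -> : #|H| = n.
  by rewrite (bij_eq_card (Bijective fK gK)) card_ord.
rewrite -mux; apply/existsP/existsP => [[x /eqP /fixE /eqP]|[x /eqP hx]].
  by exists (f x).
by exists (g x); rewrite gK hx.
Qed.

Lemma adj_connect_sym (G : sgraph) : connect_sym (@adj G).
Proof. exact/sym_connect_sym/adj_sym. Qed.

(** The data of the components are glued. A component has at most one fixed vertex, and has one
    exactly when its order is odd, so sending a vertex to its component matches the fixed vertices
    with the odd components. *)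
Lemma linear_forest_pairing (G : sgraph) :
    (forall C : {set G}, C \in components G ->
       exists i : nat, isomorphic (induced C) (path_graph i)) ->
  exists (mu : G -> G) c,
  [/\ pairing mu c,
      (forall x y, mu x = x -> mu y = y -> connect (@adj G) x y -> x = y)
    & #|[set x | mu x == x]| = #|[set C in components G | odd #|C|]|].
Proof.
move=> hC.
(* The data of each [C] are total functions on [G], so that gluing them is plain evaluation; a set
   that is not a component gets a dummy value. *)
have loc (C : {set G}) : exists mc : (G -> G) * (G -> bool),
    C \in components G ->
    [/\ forall x, x \in C -> [/\ mc.1 x \in C, mc.1 (mc.1 x) = x,
          mc.1 x != x -> adj x (mc.1 x) & mc.1 x = x -> mc.2 x],
        forall x y, x \in C -> y \in C -> adj x y -> mc.2 x != mc.2 y,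
        forall x y, x \in C -> y \in C -> mc.1 x = x -> mc.1 y = y -> x = y
      & [exists x in C, mc.1 x == x] = odd #|C|].
  have [CG|_] := boolP (C \in components G); last by exists (id, xpredT).
  have [i /isomorphic_path_pairing [mu [c [[muK muA cA muc] mu1 mux]]]] := hC C CG.
  pose mu' x := if insub x is Some u then val (mu u) else x.
  pose c' x := if insub x is Some u then c u else true.
  have mu'E (u : induced C) : mu' (val u) = val (mu u) by rewrite /mu' valK.
  have c'E (u : induced C) : c' (val u) = c u by rewrite /c' valK.
  have ex x : x \in C -> exists u : induced C, x = val u.
    by move=> xC; exists (Sub x xC).
  exists (mu', c') => _ /=; split.
  - move=> _ /ex[u ->]; rewrite !mu'E c'E muK; split => //.
    + exact: (valP (mu u)).
    + exact: muA.
    + by move/val_inj/muc.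
  - by move=> _ _ /ex[u ->] /ex[v ->]; rewrite !c'E; apply: cA.
  - move=> _ _ /ex[u ->] /ex[v ->]; rewrite !mu'E => /val_inj hu /val_inj hv.
    by rewrite (mu1 u v).
  - have cardC : #|induced C| = #|C| by rewrite /= card_sig; apply: eq_card.
    rewrite -cardC -mux.
    apply/existsP/existsP => [[x /andP[/ex[u ->]]]|[u /eqP hu]].
      by rewrite mu'E => /eqP/val_inj/eqP; exists u.
    by exists (val u); rewrite mu'E hu eqxx andbT (valP u).
have [mc mcP] := fin_all_exists loc.
pose cmp (x : G) : {set G} := [set y in [set: G] | connect (@adj G) x y].
have cmpG x : cmp x \in components G by apply: imset_f; rewrite inE.
have in_cmp x y : (y \in cmp x) = connect (@adj G) x y by rewrite !inE.
have xx x : x \in cmp x by rewrite in_cmp connect0.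
have cmpE x y : connect (@adj G) x y -> cmp y = cmp x.
  move=> xy; apply/setP => z; rewrite !in_cmp.
  exact/esym/(same_connect (@adj_connect_sym G) xy).
pose mu x := (mc (cmp x)).1 x; pose c x := (mc (cmp x)).2 x.
have P1 x := let: And4 h _ _ _ := mcP _ (cmpG x) in h x (xx x).
have mu1 x y : mu x = x -> mu y = y -> connect (@adj G) x y -> x = y.
  move=> hx hy xy; have [_ _ h _] := mcP _ (cmpG x).
  by apply: h => //; rewrite ?in_cmp // -(cmpE _ _ xy).
exists mu, c; split=> //; first split.
(* [mu] stays inside the component, so both applications use the same local involution. *)
- move=> x; have [h1 h2 _ _] := P1 x.
  by rewrite {1}/mu (cmpE x) // -in_cmp.
- by move=> x; have [] := P1 x.
- move=> x y xy; have cxy := connect1 xy; have [_ h _ _] := mcP _ (cmpG x).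
  by rewrite /c (cmpE _ _ cxy); apply: h => //; rewrite in_cmp.
- by move=> x; have [] := P1 x.
rewrite -(card_in_imset (f := cmp)); last first.
  move=> x y; rewrite !inE => /eqP hx /eqP hy e; apply: mu1 => //.
  by rewrite -in_cmp e.
apply: eq_card => C; rewrite !inE; apply/imsetP/andP => [[x]|[CG oC]].
  rewrite inE => /eqP hx ->; rewrite cmpG; split => //.
  have [_ _ _ <-] := mcP _ (cmpG x).
  by apply/existsP; exists x; rewrite xx; apply/eqP.
have [_ _ _] := mcP _ CG; rewrite oC => /existsP[x /andP[xC hx]].
have eC : C = cmp x.
  case/imsetP: CG xC => z _ ->; rewrite !inE /= => zx.
  exact/esym/cmpE.
by exists x; rewrite // inE /mu -eC.
Qed.

(** * Ordered pairs and adjacency of 2-tokens *)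

Definition ordered_pairs (T : finType) (W : {set {set T}}) : {set T * T} :=
  [set p | [set p.1; p.2] \in W].

Arguments ordered_pairs {T} W.

(** The fibre over a two-element set consists of the two orderings of its elements. *)
Lemma card_ordered_pairs (T : finType) (W : {set {set T}}) :
  (forall A, A \in W -> #|A| = 2) -> #|ordered_pairs W| = 2 * #|W|.
Proof.
move=> W2; rewrite -sum1_card.
rewrite (partition_big (fun p : T * T => [set p.1; p.2]) (mem W)) /=; last first.
  by move=> p; rewrite inE.
rewrite mulnC -sum_nat_const; apply: eq_bigr => A AW.
have /eqP/cards2P[a [b [ab eA]]] := W2 A AW.
have <- : #|[set (a, b); (b, a)]| = 2.
  by rewrite cards2 xpair_eqE negb_and ab.
rewrite -sum1_card; apply: eq_bigl => -[x y]; rewrite !inE /= !xpair_eqE.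
apply/andP/orP => [[_ /eqP e]|[]/andP[/eqP-> /eqP->]]; last 2 first.
- by rewrite -eA AW.
- by rewrite setUC -eA AW.
have mem w := congr1 (fun X : {set T} => w \in X) (etrans e eA).
have := mem a; have := mem b; have := mem x; have := mem y.
rewrite !inE !eqxx !orbT /= => /esym/orP[]/eqP-> /esym/orP[]/eqP->;
  rewrite ?eqxx ?orbb ?(negPf ab) ?[b == a]eq_sym ?(negPf ab) //=; by auto.
Qed.

Lemma symdiff_pairs (T : finType) (x y z : T) : x != y -> x != z -> y != z ->
  symdiff [set x; y] [set x; z] = [set y; z].
Proof.
move=> xy xz yz; apply/setP => w; rewrite !inE.
case: (eqVneq w x) => [->|_] /=; first by rewrite (negPf xy) (negPf xz).
case: (eqVneq w y) => [wy|_]; case: (eqVneq w z) => [wz|_] //=.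
by rewrite -wy -wz eqxx in yz.
Qed.

(** Sets of equal size are not nested unless they coincide, so the edge forming the symmetric
    difference has one end in each set, and what remains is a common vertex. *)
Lemma token2_adjP (G : sgraph) (A B : token_graph 2 G) : adj A B ->
  exists x y z, [/\ adj y z, val A = [set x; y] & val B = [set x; z]].
Proof.
case: A B => [A hA] [B hB]; rewrite /= /token_adj /=.
case/imsetP => -[y0 z0]; rewrite inE /= => yz0 e.
have inD w : ((w \in A) != (w \in B)) = (w \in [set y0; z0]).
  by rewrite -e !inE; case: (w \in A); case: (w \in B).
(* The ends of the edge are renamed so that [y] is the one in [A]. *)
have [y [z [yz yA inD']]] : exists y z, [/\ adj y z, y \in A
    & forall w, ((w \in A) != (w \in B)) = (w \in [set y; z])].
  case yA : (y0 \in A); first by exists y0, z0.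
  have zA : z0 \in A.
    apply: contraT => zA; have AB : A \subset B.
      apply/subsetP => w wA; have := inD w; rewrite wA !inE.
      case: (w \in B) => // /esym/orP[]/eqP ew; first by rewrite ew yA in wA.
      by rewrite ew (negPf zA) in wA.
    have AeB : A = B by apply/eqP; rewrite eqEcard AB (eqP hA) (eqP hB).
    by have := inD y0; rewrite AeB eqxx !inE eqxx.
  by exists z0, y0; rewrite adj_sym; split=> // w; rewrite setUC.
have yB : y \notin B by have := inD' y; rewrite yA !inE eqxx; case: (y \in B).
have y'z : y != z by apply: contraTneq yz => ->; rewrite adj_irr.
have zA : z \notin A.
  apply: contraT; rewrite negbK => zA; have BA : B \subset A.
    apply/subsetP => w wB; have := inD' w; rewrite wB !inE.
    by case wA: (w \in A) => // /esym/orP[]/eqP ew; rewrite ew ?yA ?zA in wA.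
  have BeA : B = A by apply/eqP; rewrite eqEcard BA (eqP hA) (eqP hB).
  by rewrite BeA yA in yB.
have zB : z \in B.
  by have := inD' z; rewrite (negPf zA) !inE eqxx orbT; case: (z \in B).
have : #|A :\ y| == 1 by move: hA; rewrite (cardsD1 y) yA.
case/cards1P => x hx; exists x, y, z.
have : x \in A :\ y by rewrite hx inE.
rewrite !inE => /andP[xy xA].
have xz : x != z by apply: contraTneq xA => ->.
have xB : x \in B.
  by have := inD' x; rewrite xA !inE (negPf xy) (negPf xz); case: (x \in B).
split=> //; apply/esym/eqP; rewrite eqEcard.
- by rewrite (eqP hA) cards2 xy andbT; apply/subsetP => w /set2P[]->.
- by rewrite (eqP hB) cards2 xz andbT; apply/subsetP => w /set2P[]->.
Qed.

(** * The upper bound and an independent set attaining it *)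

Section TokenIndependence.
Variables (G : sgraph) (mu : G -> G) (c : G -> bool).
Hypothesis mu_c : pairing mu c.

Let F := [set x | mu x == x].
Let tau (p : G * G) := if p.2 \in F then (mu p.1, p.2) else (p.1, mu p.2).

Let muK : involutive mu. Proof. by case: mu_c. Qed.

Let mu_fix x : (mu x \in F) = (x \in F).
Proof. by rewrite !inE muK eq_sym. Qed.

(** Since [mu] preserves [F], [tau] never changes whether the second coordinate is in [F], so its
    second application takes the same branch. *)
Let tauK : involutive tau.
Proof.
case=> x y; rewrite {2}/tau /=; case: ifP => h; rewrite /tau /= ?mu_fix h /=;
  by rewrite muK.
Qed.

Let fixed_pairs := [set p : G * G | (p.1 \in F) && (p.2 \in F)].
Let fixed_diag := [set (x, x) | x in F].

Let tau_fixed p : p \in fixed_pairs -> tau p = p.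
Proof.
by case: p => x y; rewrite inE /tau /= => /andP[]; rewrite !inE => /eqP-> ->.
Qed.

Let card_fixed_pairs : #|fixed_pairs| = #|F| ^ 2.
Proof. by rewrite -mulnn -cardsX; apply: eq_card => -[x y]; rewrite !inE. Qed.

Let card_fixed_diag : #|fixed_diag| = #|F|.
Proof. by rewrite card_imset // => x y []. Qed.

Let fixed_diag_sub : fixed_diag \subset fixed_pairs.
Proof. by apply/subsetP => _ /imsetP[x xF ->]; rewrite inE /= xF. Qed.

Let card_orbits (P : {set G * G}) :
  2 * #|P| = #|P :|: (tau @: P)| + #|P :&: (tau @: P)|.
Proof.
by rewrite cardsUI card_imset ?mul2n ?addnn //; apply: inv_inj.
Qed.

(** The two sizes are [m ^ 2 - t] and [t ^ 2 - t], for [m = #|G|] and [t = #|F|]; the summand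
    [2 * #|F|] on the left avoids truncated subtraction. *)
Let card_bound :
  #|~: fixed_diag| + #|fixed_pairs :\: fixed_diag| + 2 * #|F| = #|G| ^ 2 + #|F| ^ 2.
Proof.
have := cardsC fixed_diag; have := subset_leq_card fixed_diag_sub.
rewrite cardsD (setIidPr fixed_diag_sub) card_prod card_fixed_diag card_fixed_pairs.
by rewrite -!mulnn; lia.
Qed.

Lemma independent_token_le (S : {set token_graph 2 G}) : independent S ->
  4 * #|S| + 2 * #|F| <= #|G| ^ 2 + #|F| ^ 2.
Proof.
move=> indS; pose W := [set val A | A in S]; pose P := ordered_pairs W.
have W2 A : A \in W -> #|A| = 2 by case/imsetP => B _ ->; apply/eqP/(valP B).
have cardP : #|P| = 2 * #|S|.
  by rewrite card_ordered_pairs // card_imset //; apply: val_inj.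
have neqP x y : (x, y) \in P -> x != y.
  by rewrite inE /= => /W2; rewrite cards2; case: (x != y).
have symP x y : (x, y) \in P -> (y, x) \in P by rewrite !inE /= setUC.
have indP x y z : adj y z -> (x, y) \in P -> (x, z) \in P -> False.
  move=> yz xyP xzP; have yNz: y != z by apply: contraTneq yz => ->; rewrite adj_irr.
  have := xyP; have := xzP; rewrite !inE /= => /imsetP[B BS eB] /imsetP[A AS eA].
  have /forallP/(_ A) := indS; rewrite AS /= => /forallP/(_ B); rewrite BS /=.
  rewrite /token_adj -eA -eB symdiff_pairs ?(neqP _ _ xyP) ?(neqP _ _ xzP) // => /imsetP[].
  by exists (y, z); rewrite ?inE.
have muA x : x \notin F -> adj x (mu x) by case: mu_c => _ h _ _; rewrite inE => /h.
(* Outside [fixed_pairs], [tau] moves one coordinate along an edge and keeps the other, so [p] and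
   [tau p] would give adjacent tokens. *)
have tauP p : p \in P -> tau p \in P -> p \in fixed_pairs.
  case: p => x y; rewrite /tau /=; case: ifP => [yF | /negbT yF].
    case: (boolP (x \in F)) => [xF|xF]; first by move=> _ _; rewrite inE /= xF.
    by move=> h1 h2; case: (@indP y x (mu x)); rewrite ?muA // symP.
  by move=> h1 h2; case: (@indP x y (mu y)); rewrite ?muA.
have Pd p : p \in P -> p \notin fixed_diag.
  move=> pP; apply/negP => /imsetP[x _ e]; rewrite e in pP.
  by have := neqP _ _ pP; rewrite eqxx.
(* [tau] fixes the diagonal pairs, so [tau @: P] misses them because [P] does. *)
have le1 : P :|: (tau @: P) \subset ~: fixed_diag.
  apply/subsetP => p; rewrite inE [in X in _ -> X]inE => /orP[/Pd//|/imsetP[q qP ->]].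
  apply/negP => h; have := Pd q qP; case/negP.
  by rewrite -[q]tauK tau_fixed // (subsetP fixed_diag_sub).
have le2 : P :&: (tau @: P) \subset fixed_pairs :\: fixed_diag.
  apply/subsetP => p; rewrite inE => /andP[pP /imsetP[q qP e]].
  by rewrite inE Pd // tauP // e tauK.
have -> : 4 * #|S| = 2 * #|P| by rewrite cardP mulnA.
rewrite -card_bound leq_add2r card_orbits.
by apply: leq_add; apply: subset_leq_card.
Qed.

Lemma exists_independent_token :
    (forall x y, mu x = x -> mu y = y -> connect (@adj G) x y -> x = y) ->
  exists2 S : {set token_graph 2 G}, independent S
    & 4 * #|S| + 2 * #|F| = #|G| ^ 2 + #|F| ^ 2.
Proof.
move=> mu1; have [_ muA cA muc] := mu_c.
(* An exclusive or of being connected and having the same colour: a step along an edge changes only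
   the latter, hence flips [good]. *)
pose good x y := connect (@adj G) x y != (c x == c y).
have goodC x y : good x y = good y x by rewrite /good adj_connect_sym [c x == _]eq_sym.
have goodF x : good x x = false by rewrite /good connect0 eqxx.
have goodN x y z : adj y z -> good x z = ~~ good x y.
  move=> yz; rewrite /good; have -> : connect (@adj G) x z = connect (@adj G) x y.
    rewrite ![connect _ x _]adj_connect_sym.
    exact/esym/(same_connect (@adj_connect_sym G) (connect1 yz)).
  by have := cA _ _ yz; case: connect (c x) (c y) (c z) => [] [] [] [].
pose W := [set A : {set G} | [exists x, exists y, (A == [set x; y]) && good x y]].
have W2 A : A \in W -> #|A| = 2.
  rewrite inE => /existsP[x /existsP[y /andP[/eqP-> g]]]; rewrite cards2.
  by case: eqVneq g => // ->; rewrite goodF.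
have inW x y : ([set x; y] \in W) = good x y.
  rewrite inE; apply/existsP/idP => [[u /existsP[v /andP[/eqP e g]]]|g]; last first.
    by exists x; apply/existsP; exists y; rewrite eqxx.
  have mem w := congr1 (fun X : {set G} => w \in X) e.
  have := mem u; have := mem v; rewrite !inE !eqxx orbT.
  case/orP=> /eqP ev; case/orP=> /eqP eu; subst u v; rewrite ?goodF // in g *.
  by rewrite goodC.
pose S : {set token_graph 2 G} := [set A | val A \in W].
have eW : W = [set val A | A in S].
  apply/setP => A; apply/idP/imsetP => [AW|[B]]; last by rewrite inE => ? ->.
  have A2 : #|A| == 2 by apply/eqP/W2.
  by exists (Sub A A2); rewrite // in_set.
exists S.
  (* Adjacent tokens share [x] and differ by the edge from [y] to [z], so exactly one of them is
     good. *)
  apply/forallP => A; apply/implyP; rewrite inE => AS; apply/forallP => B.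
  apply/implyP; rewrite inE => BS; apply/negP => /token2_adjP[x [y [z [yz eA eB]]]].
  by move: AS BS; rewrite eA eB !inW (goodN _ _ _ yz) => ->.
pose P := ordered_pairs W.
have cardP : #|P| = 2 * #|S|.
  by rewrite card_ordered_pairs // eW card_imset //; apply: val_inj.
have inP x y : ((x, y) \in P) = good x y by rewrite inE inW.
have tauP p : p \notin fixed_pairs -> (tau p \in P) = (p \notin P).
  case: p => x y; rewrite inE /= negb_and /tau /= => h.
  case: ifP => [yF|/negbT yF]; rewrite !inP.
    rewrite yF orbF in h; rewrite inE in h.
    by rewrite goodC (goodN _ _ _ (muA _ h)) goodC.
  by rewrite inE in yF; rewrite (goodN _ _ _ (muA _ yF)).
(* Fixed vertices all have colour [true], so a pair of them is good exactly when they lie in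
   different components, which by [mu1] means when they are distinct. *)
have fixP p : p \in fixed_pairs -> (p \in P) = (p \notin fixed_diag).
  case: p => x y; rewrite inE inP /= => /andP[xF yF].
  have /eqP hx := xF; have /eqP hy := yF; rewrite !inE in xF yF hx hy.
  rewrite /good !muc ?(eqP xF) ?(eqP yF) // eqxx.
  case: (eqVneq x y) => [<-|xy].
    by rewrite connect0; apply/esym/negbTE; rewrite negbK imset_f // inE.
  have -> : connect (@adj G) x y = false.
    apply/negP => /(mu1 _ _ (eqP xF) (eqP yF)) e; by rewrite e eqxx in xy.
  by apply/esym/imsetP => -[z _ [e1 e2]]; rewrite e1 e2 eqxx in xy.
have in_tau p : (p \in tau @: P) = (tau p \in P).
  apply/imsetP/idP => [[q qP ->]|h]; first by rewrite tauK.
  by exists (tau p); rewrite ?tauK.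
(* Both inclusions behind the upper bound become equalities for this [P]. *)
have e1 : P :|: (tau @: P) = ~: fixed_diag.
  apply/setP => p; rewrite inE in_tau [in RHS]inE.
  case: (boolP (p \in fixed_pairs)) => h.
    by rewrite tau_fixed // fixP // orbb.
  by rewrite tauP // orbN; apply/esym; apply: contra h => /(subsetP fixed_diag_sub).
have e2 : P :&: (tau @: P) = fixed_pairs :\: fixed_diag.
  apply/setP => p; rewrite inE in_tau [in RHS]inE.
  case: (boolP (p \in fixed_pairs)) => h.
    by rewrite tau_fixed // fixP // andbb andbT.
  by rewrite tauP // andbN andbF.
have -> : 4 * #|S| = 2 * #|P| by rewrite cardP mulnA.
by rewrite -card_bound card_orbits e1 e2.
Qed.

End TokenIndependence.

Theorem theorem4 (G : sgraph) (m t : nat) (hG : #|G| = m) (hm : 2 <= m)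
    (hpaths : forall C : {set G}, C \in components G ->
       exists i : nat, 1 <= i <= m /\ isomorphic (induced C) (path_graph i))
    (ht : t = #|[set C in components G | odd #|C|]|) :
  ((independence_number (token_graph 2 G))%:R
    = (m%:R ^+ 2 + t%:R ^+ 2 - 2 * t%:R) / 4 :> rat)%R.
Proof.
have [|mu [c [mu_c mu1 cardF]]] := @linear_forest_pairing G.
  by move=> C /hpaths[i [_ iso]]; exists i.
have [S indS cardS] := exists_independent_token _ _ _ mu_c mu1.
have alphaE : independence_number (token_graph 2 G) = #|S|.
  apply/eqP; rewrite eqn_leq; apply/andP; split; last first.
    exact: (leq_bigmax_cond (F := fun S : {set token_graph 2 G} => #|S|)).
  apply/bigmax_leqP => S' /(independent_token_le _ _ _ mu_c).
  by rewrite -cardS; lia.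
rewrite alphaE; move: cardS; rewrite cardF -ht hG.
(* The identity over the naturals has no subtraction or division, so it casts to the rationals term
   by term. *)
move/(congr1 (fun n : nat => n%:R : rat)%R); rewrite !natrD !natrX => e.
lra.
Qed.
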